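(* Let $p\ge2$, let $\gamma_p\in\Pi(\mu_1,\dots,\mu_N)$ be such that $\operatorname{spt}\gamma_p$ is $c_p$-monotone, and let $S\subset\{1,\dots,N\}$, $S\ne\{1,\dots,N\}$. Then there exists a countable cover $\{U_m\}_{m\in\mathbb N}$ of the set $D_S\cap\operatorname{spt}\gamma_p$ with the following property: for every $m\in\mathbb N$ there exists $L_m>0$ such that $$|\overline x_p(\mathbf y)-\overline x_p(\tilde{\mathbf y})|\ge L_m\Big(\sum_{j\notin S}|y_j-\tilde y_j|^2\Big)^{\frac12}$$ for every $\mathbf y=(y_1,\dots,y_N),\ \tilde{\mathbf y}=(\tilde y_1,\dots,\tilde y_N)\in D_S\cap\operatorname{spt}\gamma_p\cap U_m$.
   Context: Here $p<\infty$. Fix weights $\lambda_1,\dots,\lambda_N>0$ with $\sum_i\lambda_i=1$ and Borel probability measures $\mu_1,\dots,\mu_N$ on $\mathbb R^d$ with finite $p$-th moments. $\Pi(\mu_1,\dots,\mu_N)$ is the set of Borel probability measures on $\mathbb R^{Nd}=(\mathbb R^d)^N$ with $i$-th marginal $\mu_i$ for every $i$. $\overline x_p(x_1,\dots,x_N)$ is the unique minimizer over $z\in\mathbb R^d$ of $\sum_{i=1}^N\lambda_i|x_i-z|^p$, and $c_p(x_1,\dots,x_N):=\min_{z\in\mathbb R^d}\sum_{i=1}^N\lambda_i|x_i-z|^p$. For $S\subset\{1,\dots,N\}$, $D_S:=\{\mathbf x=(x_1,\dots,x_N)\in\mathbb R^{Nd}:\ \overline x_p(\mathbf x)=x_i\text{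 for every }i\in S,\text{ and }\overline x_p(\mathbf x)\ne x_i\text{ for every }i\notin S\}$. A set $\Gamma\subset\mathbb R^{Nd}$ is $c_p$-monotone if for all $(x_1^1,\dots,x_N^1),(x_1^2,\dots,x_N^2)\in\Gamma$ and all permutations $\sigma_1,\dots,\sigma_N$ of $\{1,2\}$, $c_p(x^1_1,\dots,x^1_N)+c_p(x^2_1,\dots,x^2_N)\le c_p(x^{\sigma_1(1)}_1,\dots,x^{\sigma_N(1)}_N)+c_p(x^{\sigma_1(2)}_1,\dots,x^{\sigma_N(2)}_N)$. *)

(* Defs.v *)
From HB Require Import structures.
From mathcomp Require Import all_boot all_order all_algebra perm.
From mathcomp Require Import all_classical all_reals all_analysis.

Set Implicit Arguments.
Unset Strict Implicit.
Unset Printing Implicit Defensive.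
Import Order.TTheory GRing.Theory Num.Theory.
Import numFieldNormedType.Exports.
Local Open Scope classical_set_scope.
Local Open Scope ring_scope.

(* An N-tuple of points of R^d is a matrix x : 'M[R]_(N, d) whose i-th row
   [row i x] is the point x_i.  The matrix topology is the usual topology of
   R^{Nd}. *)

(* The library norm on matrices is the sup norm, hence this definition. *)
Definition enorm (R : realType) (d : nat) (v : 'rV[R]_d) : R :=
  Num.sqrt (\sum_(j < d) v ord0 j ^+ 2).

Notation borelType T := (g_sigma_algebraType (@open T)).

Definition lp_energy (R : realType) (N d : nat) (p : R) (lam : 'I_N -> R)
    (x : 'M[R]_(N, d)) (z : 'rV[R]_d) : R :=
  \sum_(i < N) lam i * enorm (row i x - z) `^ p.

(* A chosen minimizer, with junk value 0 if there is none; for p > 1 and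
   positive weights summing to 1 the minimizer exists and is unique. *)
Definition barycenter (R : realType) (N d : nat) (p : R) (lam : 'I_N -> R)
    (x : 'M[R]_(N, d)) : 'rV[R]_d :=
  xget 0 [set z | forall w, lp_energy p lam x z <= lp_energy p lam x w].

(* The minimum is attained, so it is the infimum. *)
Definition lp_cost (R : realType) (N d : nat) (p : R) (lam : 'I_N -> R)
    (x : 'M[R]_(N, d)) : R :=
  inf (range (lp_energy p lam x)).

Definition spt (R : realType) (T : ptopologicalType)
    (mu : probability (borelType T) R) : set T :=
  [set x | forall U : set T, open U -> U x -> (0 < mu U)%E].

Definition finite_moment (R : realType) (d : nat) (p : R)
    (mu : probability (borelType 'rV[R]_d) R) : Prop :=
  (\int[mu]_x (enorm (x : 'rV[R]_d) `^ p)%:E < +oo)%E.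

(* Pi(mu_1, ..., mu_N) *)
Definition coupling (R : realType) (N d : nat)
    (mu : 'I_N -> probability (borelType 'rV[R]_d) R) :
    set (probability (borelType 'M[R]_(N, d)) R) :=
  [set gamma | forall (i : 'I_N) (A : set (borelType 'rV[R]_d)),
    measurable A -> pushforward gamma
      (fun x : borelType 'M[R]_(N, d) => row i x : borelType 'rV[R]_d) A
    = mu i A].

Definition DS (R : realType) (N d : nat) (p : R) (lam : 'I_N -> R)
    (S : {set 'I_N}) : set 'M[R]_(N, d) :=
  [set x | (forall i, i \in S -> barycenter p lam x = row i x) /\
           (forall i, i \notin S -> barycenter p lam x <> row i x)].

(* The two points of Gamma are x ord0 and x ord_max; the permutations of {1,2}
   act on the index k : 'I_2. *)
Definition lp_monotone (R : realType) (N d : nat) (p : R) (lam : 'I_N -> R)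
    (Gamma : set 'M[R]_(N, d)) : Prop :=
  forall (x : 'I_2 -> 'M[R]_(N, d)) (s : 'I_N -> 'S_2),
    (forall k, Gamma (x k)) ->
    \sum_(k < 2) lp_cost p lam (x k) <=
    \sum_(k < 2) lp_cost p lam (\matrix_(i < N) row i (x (s i k))).

(* Main.v *)
(* Fix j outside S and exchange the j-th rows of two points y, y' of the support.
   Write z, z' for their barycenters, v = y_j - z, e = y'_j - y_j,
   zeta = z' - z, and G(v) = |v|^(p-2) v.  In the two exchanged costs use the
   competitors z + t e and z' - t e.  By stationarity of z and z' and the local
   Lipschitz bound on G, the rows other than j cost only K t^2 |e|^2 to second
   order, while by strong monotonicity of G the row j gains
   t (1 - t) |v|^(p-2) |e|^2 / 2 up to an error K (|zeta| + |e|) |zeta|.  For t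
   small, c-monotonicity then forces |e| <= C |zeta|, where C depends only on a
   lower bound for |v| and an upper bound for y, y', z, z'.  The cover
   consists of the sets on which such bounds hold with constants 1/k and k. *)
Require Import Defs.
From mathcomp Require Import all_boot all_order all_algebra perm.
From mathcomp Require Import all_classical all_reals all_analysis.
From mathcomp Require Import ring lra.
Set Implicit Arguments.
Unset Strict Implicit.
Unset Printing Implicit Defensive.
Import Order.TTheory GRing.Theory Num.Theory.
Import numFieldNormedType.Exports.
Local Open Scope classical_set_scope.
Local Open Scope ring_scope.

(** * The Euclidean inner product and norm on row vectors *)

Definition dotr (R : realType) (d : nat) (u v : 'rV[R]_d) : R :=
  \sum_(k < d) u ord0 k * v ord0 k.

Lemma dotrC (R : realType) (d : nat) (u v : 'rV[R]_d) : dotr u v = dotr v u.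
Proof. by apply: eq_bigr => k _; rewrite mulrC. Qed.

Lemma dotrDl (R : realType) (d : nat) (u v w : 'rV[R]_d) :
  dotr (u + v) w = dotr u w + dotr v w.
Proof. by rewrite -big_split; apply: eq_bigr => k _; rewrite mxE mulrDl. Qed.

Lemma dotrZl (R : realType) (d : nat) (a : R) (u w : 'rV[R]_d) :
  dotr (a *: u) w = a * dotr u w.
Proof. by rewrite mulr_sumr; apply: eq_bigr => k _; rewrite mxE mulrA. Qed.

Lemma dotrDr (R : realType) (d : nat) (w u v : 'rV[R]_d) :
  dotr w (u + v) = dotr w u + dotr w v.
Proof. by rewrite dotrC dotrDl !(dotrC w). Qed.

Lemma dotrZr (R : realType) (d : nat) (a : R) (w u : 'rV[R]_d) :
  dotr w (a *: u) = a * dotr w u.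
Proof. by rewrite dotrC dotrZl (dotrC w). Qed.

Lemma dotrNl (R : realType) (d : nat) (u w : 'rV[R]_d) :
  dotr (- u) w = - dotr u w.
Proof. by rewrite -scaleN1r dotrZl mulN1r. Qed.

Lemma dotrNr (R : realType) (d : nat) (w u : 'rV[R]_d) :
  dotr w (- u) = - dotr w u.
Proof. by rewrite dotrC dotrNl dotrC. Qed.

Lemma dot0r (R : realType) (d : nat) (u : 'rV[R]_d) : dotr 0 u = 0.
Proof. by rewrite /dotr big1 // => k _; rewrite mxE mul0r. Qed.

Lemma dotr_suml (R : realType) (d : nat) (I : Type) (r : seq I) (P : pred I)
    (F : I -> 'rV[R]_d) (w : 'rV[R]_d) :
  dotr (\sum_(i <- r | P i) F i) w = \sum_(i <- r | P i) dotr (F i) w.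
Proof.
exact: (big_morph (fun u => dotr u w) (fun u v => dotrDl u v w) (dot0r w)).
Qed.

Definition dotrE := (dotrDl, dotrDr, dotrNl, dotrNr, dotrZl, dotrZr).

Lemma dotr_ge0 (R : realType) (d : nat) (u : 'rV[R]_d) : 0 <= dotr u u.
Proof. by apply: sumr_ge0 => k _; rewrite -expr2 sqr_ge0. Qed.

Lemma enorm_ge0 (R : realType) (d : nat) (u : 'rV[R]_d) : 0 <= enorm u.
Proof. exact: sqrtr_ge0. Qed.

Lemma sqr_enorm (R : realType) (d : nat) (u : 'rV[R]_d) :
  enorm u ^+ 2 = dotr u u.
Proof.
rewrite sqr_sqrtr; first by apply: eq_bigr => k _; rewrite expr2.
by apply: sumr_ge0 => k _; rewrite sqr_ge0.
Qed.

Lemma enorm_dotr (R : realType) (d : nat) (u : 'rV[R]_d) :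
  enorm u = Num.sqrt (dotr u u).
Proof. by rewrite -sqr_enorm sqrtr_sqr ger0_norm ?enorm_ge0. Qed.

Lemma coord_le_enorm (R : realType) (d : nat) (u : 'rV[R]_d) (k : 'I_d) :
  `|u ord0 k| <= enorm u.
Proof.
rewrite -ler_sqr ?nnegrE ?enorm_ge0// sqr_enorm real_normK ?num_real//.
rewrite /dotr (bigD1 k)//= -expr2 lerDl.
by apply: sumr_ge0 => i _; rewrite -expr2 sqr_ge0.
Qed.

Lemma enorm_eq0 (R : realType) (d : nat) (u : 'rV[R]_d) : enorm u = 0 -> u = 0.
Proof.
move=> u0; apply/rowP => k; apply/eqP; rewrite mxE -normr_le0 -u0.
exact: coord_le_enorm.
Qed.

(** Cauchy-Schwarz: expand the square of [enorm v *: u - enorm u *: v] and cancel the product of the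
    norms; if that product is 0, one of the two vectors vanishes. *)
Lemma dotr_le_enorm (R : realType) (d : nat) (u v : 'rV[R]_d) :
  dotr u v <= enorm u * enorm v.
Proof.
have u0 := enorm_ge0 u; have v0 := enorm_ge0 v.
have := dotr_ge0 (enorm v *: u - enorm u *: v).
rewrite !dotrE -!sqr_enorm (dotrC v u).
have [uv0|uvN0] := eqVneq (enorm u * enorm v) 0; last first.
  have uv_gt0 : 0 < enorm u * enorm v by rewrite lt_neqAle eq_sym uvN0 mulr_ge0.
  move=> h; rewrite -(ler_pM2l uv_gt0); nra.
rewrite uv0 => _; suff -> : dotr u v = 0 by [].
move/eqP: uv0; rewrite mulf_eq0 => /orP[] /eqP /enorm_eq0 ->.
  exact: dot0r.
by rewrite dotrC dot0r.
Qed.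

Lemma enormN (R : realType) (d : nat) (u : 'rV[R]_d) : enorm (- u) = enorm u.
Proof. by rewrite !enorm_dotr dotrNl dotrNr opprK. Qed.

Lemma enormZ (R : realType) (d : nat) (a : R) (u : 'rV[R]_d) :
  enorm (a *: u) = `|a| * enorm u.
Proof.
by rewrite !enorm_dotr dotrZl dotrZr mulrA -expr2 sqrtrM ?sqr_ge0// sqrtr_sqr.
Qed.

Lemma enormD (R : realType) (d : nat) (u v : 'rV[R]_d) :
  enorm (u + v) <= enorm u + enorm v.
Proof.
rewrite -ler_sqr ?nnegrE ?addr_ge0 ?enorm_ge0// sqr_enorm !dotrE (dotrC v u).
have := dotr_le_enorm u v; rewrite -!sqr_enorm; lra.
Qed.

Lemma enormB (R : realType) (d : nat) (u v : 'rV[R]_d) :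
  enorm (u - v) <= enorm u + enorm v.
Proof. by rewrite -(enormN v) enormD. Qed.

Lemma ler_enorm_dist (R : realType) (d : nat) (u v : 'rV[R]_d) :
  enorm u - enorm v <= enorm (u - v).
Proof. by rewrite lerBlDr -{1}(subrK v u) enormD. Qed.

(** * Convexity and Lipschitz estimates for powers and for [pgrad] *)

Lemma powR_tangent (R : realType) (p a b : R) : 1 <= p -> 0 <= a -> 0 <= b ->
  a `^ p + p * a `^ (p - 1) * (b - a) <= b `^ p.
Proof.
move=> p1 a0 b0; have [<-|pN1] := eqVneq 1 p.
  rewrite subrr powRr0 !powRr1//; lra.
have {pN1}p1 : 1 < p by rewrite lt_neqAle pN1.
have p0 : 0 < p by lra.
have pm0 : 0 < p - 1 by lra.
have q0 : 0 < p / (p - 1) by rewrite divr_gt0.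
have E : p^-1 + (p / (p - 1))^-1 = 1 by field; rewrite !gt_eqF.
(* Young's inequality for b and a^(p-1), with exponents p and p/(p-1), becomes the tangent
   inequality after multiplication by p. At p = 1 the second exponent degenerates, hence the
   separate case above. *)
have := conjugate_powR b0 (powR_ge0 a (p - 1)) p0 q0 E.
rewrite -powRrM [_ * (p / _)]mulrC divfK ?gt_eqF// -(ler_pM2l p0).
rewrite -(mulr_powRB1 a0 p0).
set c := a `^ (p - 1); rewrite invf_div.
have -> : p * (b `^ p / p + a * c * ((p - 1) / p)) = b `^ p + (p - 1) * (a * c).
  by field; rewrite gt_eqF.
lra.
Qed.

(** The tangent at [a], whose slope is at most p M^(p-1). One sign suffices, since [a] and [b] may
    be exchanged. *)
Lemma powR_dist_le (R : realType) (p M a b : R) : 1 <= p ->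
  0 <= a <= M -> 0 <= b <= M ->
  a `^ p - b `^ p <= p * M `^ (p - 1) * `|a - b|.
Proof.
move=> p1 /andP[a0 aM] /andP[b0 bM].
have := powR_tangent p1 a0 b0.
have : a `^ (p - 1) <= M `^ (p - 1).
  by apply: ge0_ler_powR; rewrite ?nnegrE ?subr_ge0//; apply: le_trans aM.
have := powR_ge0 a (p - 1); set A := a `^ (p - 1); set B := M `^ (p - 1).
move=> A0 AB h; have : p * A * (a - b) <= p * B * `|a - b|.
  apply: le_trans (_ : p * A * `|a - b| <= _).
    by rewrite ler_wpM2l ?ler_norm ?mulr_ge0//; lra.
  by rewrite ler_wpM2r// ler_wpM2l//; lra.
lra.
Qed.

(* The gradient of [|v|^p / p]. *)
Definition pgrad (R : realType) (d : nat) (p : R) (v : 'rV[R]_d) : 'rV[R]_d :=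
  enorm v `^ (p - 2) *: v.

(** The scalar tangent inequality at |v|, because v.(w - v) <= |v| (|w| - |v|) by Cauchy-Schwarz. *)
Lemma pgrad_tangent (R : realType) (d : nat) (p : R) (v w : 'rV[R]_d) :
  2 <= p ->
  enorm v `^ p + p * dotr (pgrad p v) (w - v) <= enorm w `^ p.
Proof.
move=> p2; have v0 := enorm_ge0 v; have w0 := enorm_ge0 w.
apply: le_trans (powR_tangent _ v0 w0); last by lra.
rewrite lerD2l -mulrA ler_wpM2l//; first by lra.
have pm0 : 0 < p - 1 by lra.
rewrite -(mulr_powRB1 v0 pm0) (_ : p - 1 - 1 = p - 2);
  last by lra.
rewrite dotrZl !dotrE -sqr_enorm.
have := dotr_le_enorm v w; have := powR_ge0 (enorm v) (p - 2).
set A := _ `^ _ => A0 h.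
have : A * dotr v w <= A * (enorm v * enorm w) by rewrite ler_wpM2l.
lra.
Qed.

(* The two sides differ by
   [(|a|^(p-2) - |b|^(p-2)) (|a|^2 - |b|^2) / 2 >= 0]. *)
Lemma pgrad_strong_mono (R : realType) (d : nat) (p : R) (a b : 'rV[R]_d) :
  2 <= p ->
  enorm b `^ (p - 2) * enorm (a - b) ^+ 2 / 2
    <= dotr (pgrad p a - pgrad p b) (a - b).
Proof.
move=> p2; rewrite sqr_enorm /pgrad !dotrE (dotrC b a) -!sqr_enorm.
have a0 := enorm_ge0 a; have b0 := enorm_ge0 b.
have := powR_ge0 (enorm a) (p - 2); have := powR_ge0 (enorm b) (p - 2).
have : 0 <= (enorm a `^ (p - 2) - enorm b `^ (p - 2)) *
            (enorm a ^+ 2 - enorm b ^+ 2).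
  wlog ab : a b a0 b0 / enorm b <= enorm a.
    move=> h; have /orP[|] := le_total (enorm b) (enorm a); first exact: h.
    by move/(h b a b0 a0); rewrite -mulrNN !opprB.
  rewrite mulr_ge0// subr_ge0 ?ler_sqr//.
  by rewrite ge0_ler_powR ?nnegrE//; lra.
(* The difference of the two sides also contains the nonnegative term |a|^(p-2) |a - b|^2 / 2. *)
have := dotr_ge0 (a - b); rewrite !dotrE (dotrC b a) -!sqr_enorm.
set A := _ `^ _; set B := _ `^ _ => h1 h2 B0 A0.
nra.
Qed.

(** For p < 3 the factor |v|^(p-2) alone is not Lipschitz at 0. With |b| <= |a|, split off |a|^(p-2)
    (a - b); the remainder (|a|^(p-2) - |b|^(p-2)) |b| is controlled by the tangent inequality for
    the exponent p - 1 >= 1, which bounds it by (p-2) |a|^(p-2) (|a| - |b|). *)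
Lemma pgrad_lipschitz (R : realType) (d : nat) (p M : R) (a b : 'rV[R]_d) :
  2 <= p -> enorm a <= M -> enorm b <= M ->
  enorm (pgrad p a - pgrad p b) <= p * M `^ (p - 2) * enorm (a - b).
Proof.
move=> p2; wlog ab : a b / enorm b <= enorm a.
  move=> h aM bM; have /orP[ba|ab] := le_total (enorm b) (enorm a); first exact: h.
  by rewrite -enormN opprB -(enormN (a - b)) opprB; apply: h.
move=> aM bM; have a0 := enorm_ge0 a; have b0 := enorm_ge0 b.
have -> : pgrad p a - pgrad p b = enorm a `^ (p - 2) *: (a - b)
    + (enorm a `^ (p - 2) - enorm b `^ (p - 2)) *: b.
  by rewrite /pgrad scalerBr scalerBl addrA subrK.
apply: le_trans (enormD _ _) _; rewrite !enormZ.
have AB : enorm b `^ (p - 2) <= enorm a `^ (p - 2).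
  by rewrite ge0_ler_powR ?nnegrE//; lra.
have AM : enorm a `^ (p - 2) <= M `^ (p - 2).
  by rewrite ge0_ler_powR ?nnegrE//; lra.
have A0 := powR_ge0 (enorm a) (p - 2).
rewrite (ger0_norm A0) ger0_norm ?subr_ge0//.
have p1 : 1 <= p - 1 by lra.
have pm0 : 0 < p - 1 by lra.
have := powR_tangent p1 a0 b0.
rewrite -(mulr_powRB1 a0 pm0) -(mulr_powRB1 b0 pm0) (_ : p - 1 - 1 = p - 2);
  last by lra.
have := ler_enorm_dist a b; have := enorm_ge0 (a - b).
move: AM AB A0; set A := _ `^ _; set C := _ `^ _; set B := _ `^ _.
move=> AM AB A0 d0 dab h.
have : (p - 1) * A * (enorm a - enorm b) <= (p - 1) * A * enorm (a - b).
  by rewrite ler_wpM2l ?mulr_ge0//; lra.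
have : p * A * enorm (a - b) <= p * C * enorm (a - b).
  by rewrite ler_wpM2r// ler_wpM2l//; lra.
have : 0 <= A * (enorm a - enorm b) by rewrite mulr_ge0// subr_ge0.
lra.
Qed.

(** The tangent inequality at [w] bounds |w|^p from above with slope G(w); replacing G(w) by G(v)
    costs the Lipschitz error. *)
Lemma pgrad_quadratic (R : realType) (d : nat) (p M : R) (v w : 'rV[R]_d) :
  2 <= p -> enorm v <= M -> enorm w <= M ->
  enorm w `^ p <= enorm v `^ p + p * dotr (pgrad p v) (w - v)
    + p * (p * M `^ (p - 2)) * enorm (w - v) ^+ 2.
Proof.
move=> p2 vM wM; have := @pgrad_tangent R d p w v p2.
have := @pgrad_lipschitz R d p M w v p2 wM vM.
have := dotr_le_enorm (pgrad p w - pgrad p v) (w - v).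
have d0 := enorm_ge0 (w - v); have p0 : 0 <= p by lra.
set K := p * M `^ _ => h /(ler_wpM2r d0) h'.
have /(ler_wpM2l p0) := le_trans h h'.
rewrite !dotrE; lra.
Qed.

(** * Continuity of the energy and existence of a minimizer *)

Lemma continuous_sum (R : realType) (T : topologicalType) (I : Type) (r : seq I)
    (P : pred I) (f : I -> T -> R) :
  (forall i, P i -> continuous (f i)) ->
  continuous (fun x => \sum_(i <- r | P i) f i x).
Proof.
move=> fc x; apply: cvg_big => [|i Pi]; first exact: add_continuous.
exact: fc.
Qed.

Lemma enorm_continuous (R : realType) (d : nat) : continuous (@enorm R d).
Proof.
have -> : @enorm R d = Num.sqrt \o (fun v => dotr v v).
  by apply/funext => v; rewrite enorm_dotr.
move=> z; apply: continuous_comp; last exact: sqrt_continuous.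
apply: continuous_sum => j _ {}z.
have coord : continuous (fun v : 'rV[R]_d => v ord0 j) by exact: coord_continuous.
exact: (continuousM (coord z) (coord z)).
Qed.

Lemma lp_energy_ge0 (R : realType) (N d : nat) (p : R) (lam : 'I_N -> R)
    (x : 'M[R]_(N, d)) (z : 'rV[R]_d) :
  (forall i, 0 < lam i) -> 0 <= lp_energy p lam x z.
Proof.
by move=> lam0; apply: sumr_ge0 => i _; rewrite mulr_ge0 ?powR_ge0// ltW.
Qed.

Lemma enorm_powR_continuous (R : realType) (d : nat) (p : R) (u : 'rV[R]_d) :
  1 <= p -> continuous (fun z : 'rV[R]_d => enorm (u - z) `^ p).
Proof.
move=> p1 z; set M := enorm (u - z) + 1.
have M0 : 0 <= M by rewrite addr_ge0 ?enorm_ge0.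
(* [M] bounds |u - w| for all w within distance 1 of z, so [C] is a Lipschitz constant there; the
   added 1 makes [C] positive, so that e / C is an admissible radius. *)
set C := p * M `^ (p - 1) + 1.
have C0 : 0 < C by rewrite ltr_wpDl// mulr_ge0 ?powR_ge0//; lra.
have dz : (fun w : 'rV[R]_d => enorm (z - w)) w @[w --> z] --> (0 : R).
  have -> : (0 : R) = enorm (z - z).
    by rewrite subrr enorm_dotr dot0r sqrtr0.
  apply: (@continuous_comp _ _ _ (fun w : 'rV[R]_d => z - w) (@enorm R d)).
    by apply: continuousB; first exact: cst_continuous.
  exact: enorm_continuous.
apply/(@cvgrPdist_le _ _ _ (nbhs z) (nbhs_filter z)) => e e0.
have m0 : 0 < Num.min 1 (e / C) by rewrite lt_min ltr01 divr_gt0.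
move/cvgrPdist_lt : dz => /(_ _ m0); apply: filterS => w.
rewrite sub0r normrN ger0_norm ?enorm_ge0// lt_min => /andP[d1 dC].
have wz : u - w = (u - z) + (z - w) by rewrite addrA subrK.
have zw : enorm (u - w) <= M.
  by rewrite wz; apply: le_trans (enormD _ _) _; rewrite lerD2l ltW.
have zz : enorm (u - z) <= M by rewrite lerDl.
have aux (a b : R) : 0 <= a <= M -> 0 <= b <= M -> `|a - b| <= enorm (z - w) ->
    a `^ p - b `^ p <= e.
  move=> aM bM ab; apply: le_trans (powR_dist_le p1 aM bM) _.
  rewrite ltr_pdivlMr// in dC; apply: le_trans (_ : C * enorm (z - w) <= _).
    rewrite ler_pM ?mulr_ge0 ?powR_ge0//; first lra.
    by rewrite /C lerDl.
  by rewrite mulrC ltW.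
have h : `|enorm (u - z) - enorm (u - w)| <= enorm (z - w).
  rewrite ler_norml lerNl opprB; apply/andP; split.
    by apply: le_trans (ler_enorm_dist _ _) _; rewrite wz addrAC subrr add0r.
  apply: le_trans (ler_enorm_dist _ _) _.
  by rewrite wz opprD addrA subrr sub0r enormN.
have bz : 0 <= enorm (u - z) <= M by rewrite enorm_ge0.
have bw : 0 <= enorm (u - w) <= M by rewrite enorm_ge0.
rewrite ler_norml lerNl opprB; apply/andP; split; last exact: aux.
by apply: aux => //; rewrite distrC.
Qed.

Lemma lp_energy_continuous (R : realType) (N d : nat) (p : R) (lam : 'I_N -> R)
    (x : 'M[R]_(N, d)) : 1 <= p -> continuous (lp_energy p lam x).
Proof.
move=> p1; apply: continuous_sum => i _ z.
have lamc : continuous (fun _ : 'rV[R]_d => lam i) by exact: cst_continuous.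
exact: (continuousM (lamc z) (@enorm_powR_continuous R d p (row i x) p1 z)).
Qed.

(** Coercivity: outside a large ball the term of a single row already exceeds the energy at 0, and
    on the ball the extreme value theorem applies. *)
Lemma lp_energy_minimizer (R : realType) (N d : nat) (p : R) (lam : 'I_N -> R)
    (x : 'M[R]_(N, d)) :
  1 <= p -> (forall i, 0 < lam i) -> \sum_(i < N) lam i = 1 ->
  exists z, forall w, lp_energy p lam x z <= lp_energy p lam x w.
Proof.
move=> p1 lam0 lam1.
(* The weights sum to 1, so there is at least one row. *)
have [i _] : exists i : 'I_N, true.
  case: N lam x lam0 lam1 => [|n] lam x _; last by exists ord0.
  by rewrite big_ord0 => /esym/eqP; rewrite oner_eq0.
pose E0 := lp_energy p lam x 0.
(* Beyond radius [B] the distance to row i is at least E0 / lam i + 1. The 1 makes this distance at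
   least 1, so its p-th power is no smaller than itself. *)
pose B := enorm (row i x) + (E0 / lam i + 1).
have E00 : 0 <= E0 by exact: lp_energy_ge0.
have Bi0 : 0 <= E0 / lam i by rewrite divr_ge0// ltW.
have B0 : 0 <= B by rewrite addr_ge0 ?enorm_ge0// addr_ge0.
pose A := [set z : 'rV[R]_d | enorm z <= B].
have e0 : enorm (0 : 'rV[R]_d) = 0 by rewrite enorm_dotr dot0r sqrtr0.
have A0 : A 0 by rewrite /A /= e0.
have cA : compact A.
  apply: bounded_closed_compact.
    exists B; split; first exact: num_real.
    (* Boundedness refers to the sup norm, which the Euclidean norm dominates. *)
    move=> C BC z /= zB; rewrite /Num.norm/= mx_normrE.
    apply/bigmax_leP; split; first by rewrite ltW// (le_lt_trans B0).
    move=> [k l] _ /=; rewrite (ord1 k) (le_trans (coord_le_enorm _ _))//.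
    by rewrite (le_trans zB)// ltW.
  apply: (@closed_comp _ _ (@enorm R d) [set r | r <= B]); last exact: closed_le.
  by move=> z _; exact: enorm_continuous.
have [|z zA zmin] := @EVT_min_rV R d (lp_energy p lam x) A (ex_intro _ _ A0) cA.
  by apply: continuous_subspaceT; exact: lp_energy_continuous.
exists z => w; have [wA|/negP] := boolP (enorm w <= B).
  by apply: zmin; rewrite inE.
move/negP; rewrite -ltNge => Bw.
apply: le_trans (_ : E0 <= _); first by apply: zmin; rewrite inE.
have Ei : E0 / lam i + 1 <= enorm (row i x - w).
  rewrite -enormN opprB; have := ler_enorm_dist w (row i x).
  by rewrite /B in Bw; lra.
have : 1 <= enorm (row i x - w) by lra.
move/le1r_powR => /(_ p p1) h.
rewrite /lp_energy (bigD1 i)//=.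
have : 0 <= \sum_(k < N | k != i) lam k * enorm (row k x - w) `^ p.
  by apply: sumr_ge0 => k _; rewrite mulr_ge0 ?powR_ge0// ltW.
have : E0 <= lam i * enorm (row i x - w) `^ p.
  by rewrite mulrC -ler_pdivrMr//; lra.
rewrite -/E0; lra.
Qed.

(** A minimizer exists, so [xget] does not return its default value. *)
Lemma barycenter_min (R : realType) (N d : nat) (p : R) (lam : 'I_N -> R)
    (x : 'M[R]_(N, d)) (w : 'rV[R]_d) :
  1 <= p -> (forall i, 0 < lam i) -> \sum_(i < N) lam i = 1 ->
  lp_energy p lam x (barycenter p lam x) <= lp_energy p lam x w.
Proof.
move=> p1 lam0 lam1.
exact: (xgetPex 0 (lp_energy_minimizer x p1 lam0 lam1)).
Qed.

Lemma lp_cost_le (R : realType) (N d : nat) (p : R) (lam : 'I_N -> R)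
    (x : 'M[R]_(N, d)) (w : 'rV[R]_d) :
  (forall i, 0 < lam i) -> lp_cost p lam x <= lp_energy p lam x w.
Proof.
move=> lam0; apply: ge_inf; last by exists w.
by exists 0 => _ [z _ <-]; exact: lp_energy_ge0.
Qed.

Lemma lp_cost_barycenter (R : realType) (N d : nat) (p : R) (lam : 'I_N -> R)
    (x : 'M[R]_(N, d)) :
  1 <= p -> (forall i, 0 < lam i) -> \sum_(i < N) lam i = 1 ->
  lp_cost p lam x = lp_energy p lam x (barycenter p lam x).
Proof.
move=> p1 lam0 lam1; apply/eqP; rewrite eq_le lp_cost_le//=.
apply: lb_le_inf; first by exists (lp_energy p lam x 0), 0.
by move=> _ [z _ <-]; exact: barycenter_min.
Qed.

(** * Gain and error terms of the exchanged row *)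

Lemma cross_gain (R : realType) (d : nat) (p : R) (v s eta : 'rV[R]_d) :
  2 <= p ->
  enorm (v + s) `^ p - enorm v `^ p
    + (enorm (v + eta) `^ p - enorm (v + s + eta) `^ p)
  <= p * dotr (pgrad p (v + eta) - pgrad p (v + s)) eta.
Proof.
(* In the application [v] and [v + s + eta] are the j-th rows relative to their barycenters before
   the exchange, [v + s] and [v + eta] those relative to the competitors after it. The tangent
   inequalities at [v + s] and [v + eta] are added. *)
move=> p2; have := @pgrad_tangent R d p (v + s) (v + s + eta) p2.
have := @pgrad_tangent R d p (v + eta) v p2.
rewrite (_ : v + s + eta - (v + s) = eta); last by rewrite addrAC subrr add0r.
rewrite (_ : v - (v + eta) = - eta); last by rewrite opprD addrA subrr add0r.
rewrite dotrDl dotrNl dotrNr.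
move: (dotr _ _) (dotr _ _) (_ `^ p) (_ `^ p) (_ `^ p) (_ `^ p).
move=> x y a b c e; lra.
Qed.

(** Write eta = t e - zeta and regroup the left side into one pairing with zeta and two with t e.
    The first is the Lipschitz error; of the others, one yields the gain by strong monotonicity and
    one has a favorable sign by monotonicity. *)
Lemma pgrad_swap_bound (R : realType) (d : nat) (p M t : R) (v e zeta : 'rV[R]_d) :
  2 <= p -> 0 <= t < 1 ->
  let tau := t *: e in let s := (1 - t) *: e in let eta := tau - zeta in
  enorm (v + eta) <= M -> enorm (v + s) <= M ->
  dotr (pgrad p (v + eta) - pgrad p (v + s)) eta
    + dotr (pgrad p v - pgrad p (v + s + eta)) tau
  <= p * M `^ (p - 2) * (enorm zeta + enorm e) * enorm zeta
     - t * (1 - t) * enorm v `^ (p - 2) * enorm e ^+ 2 / 2.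
Proof.
move=> p2 /andP[t0 t1] tau s eta vM sM.
have r0 : 0 < 1 - t by rewrite subr_gt0.
(* Strong monotonicity pairs with s = (1 - t) e; one factor 1 - t > 0 cancels. *)
have m1 : (1 - t) * (enorm v `^ (p - 2) * enorm e ^+ 2 / 2) <=
    dotr (pgrad p (v + s) - pgrad p v) e.
  have := @pgrad_strong_mono R d p (v + s) v p2.
  rewrite (_ : v + s - v = s); last by rewrite addrAC subrr add0r.
  rewrite dotrZr enormZ gtr0_norm// => h; rewrite -(ler_pM2l r0).
  by apply: le_trans h; rewrite le_eqVlt; apply/orP; left; apply/eqP; ring.
have m2 : 0 <= dotr (pgrad p (v + s + eta) - pgrad p (v + eta)) e.
  have := @pgrad_strong_mono R d p (v + s + eta) (v + eta) p2.
  rewrite (_ : v + s + eta - (v + eta) = s); last first.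
    by apply/rowP => k; rewrite !mxE; ring.
  rewrite dotrZr => h; rewrite -(pmulr_rge0 _ r0); apply: le_trans h.
  by rewrite divr_ge0// mulr_ge0 ?powR_ge0 ?sqr_ge0.
have m3 : - dotr (pgrad p (v + eta) - pgrad p (v + s)) zeta <=
    p * M `^ (p - 2) * (enorm zeta + enorm e) * enorm zeta.
  rewrite -dotrNr; apply: le_trans (dotr_le_enorm _ _) _; rewrite enormN.
  apply: ler_wpM2r; first exact: enorm_ge0.
  apply: le_trans (pgrad_lipschitz p2 vM sM) _.
  rewrite ler_wpM2l ?mulr_ge0 ?powR_ge0//; first by lra.
  (* Since |2t - 1| <= 1, this vector has norm at most |zeta| + |e|. *)
  have -> : v + eta - (v + s) = (2 * t - 1) *: e - zeta.
    apply/rowP => k; rewrite !mxE; ring.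
  apply: le_trans (enormB _ _) _; rewrite addrC lerD2l enormZ ler_piMl ?enorm_ge0//.
  by rewrite ler_norml; lra.
move/(ler_wpM2l t0): m1; move/(mulr_ge0 t0): m2; move: m3.
have -> : dotr (pgrad p (v + eta) - pgrad p (v + s)) eta
    + dotr (pgrad p v - pgrad p (v + s + eta)) tau
  = - dotr (pgrad p (v + eta) - pgrad p (v + s)) zeta
    - t * dotr (pgrad p (v + s) - pgrad p v) e
    - t * dotr (pgrad p (v + s + eta) - pgrad p (v + eta)) e.
  rewrite {2}/eta /tau; move: (pgrad p _) (pgrad p _) (pgrad p _) (pgrad p _).
  by move=> a b c f; rewrite !dotrE; ring.
move: (dotr _ _) (dotr _ _) (dotr _ _).
move: (enorm zeta) (enorm e) (M `^ _) (enorm v `^ _).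
move=> a b c f g h i; lra.
Qed.

(** * First-order optimality of a minimizer *)

Lemma lp_energy_stationary (R : realType) (N d : nat) (p : R) (lam : 'I_N -> R)
    (x : 'M[R]_(N, d)) (z : 'rV[R]_d) :
  2 <= p -> (forall i, 0 < lam i) -> \sum_(i < N) lam i = 1 ->
  (forall w, lp_energy p lam x z <= lp_energy p lam x w) ->
  \sum_(i < N) lam i *: pgrad p (row i x - z) = 0.
Proof.
move=> p2 lam0 lam1 zmin; have p0 : 0 < p by lra.
(* [G] is a descent direction: moving z by e G lowers the energy by p e |G|^2, up to an error p K
   e^2 |G|^2. This replaces differentiation. *)
set G := \sum_(i < N) _.
pose M := \sum_(i < N) enorm (row i x - z) + enorm G.
pose K := p * M `^ (p - 2); have K0 : 0 <= K by rewrite mulr_ge0 ?powR_ge0//; lra.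
(* With this step size e - K e^2 = e^2 > 0, so minimality forces |G| = 0; and e <= 1 keeps all
   differences below [M]. *)
pose e := (1 + K)^-1.
have e0 : 0 < e by rewrite invr_gt0; lra.
have e1 : e <= 1 by rewrite invf_le1; lra.
have xM i : enorm (row i x - z) + enorm G <= M.
  rewrite lerD2r (bigD1 i)//= lerDl.
  by apply: sumr_ge0 => k _; exact: enorm_ge0.
have up : lp_energy p lam x (z + e *: G) <= lp_energy p lam x z
    - p * e * enorm G ^+ 2 + p * K * (e * enorm G) ^+ 2.
  apply: le_trans (_ : \sum_(i < N) (lam i * enorm (row i x - z) `^ p
    - p * e * dotr (lam i *: pgrad p (row i x - z)) G
    + lam i * (p * K * (e * enorm G) ^+ 2)) <= _).
    apply: ler_sum => i _.
    have h1 : enorm (row i x - z) <= M.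
      by apply: le_trans (xM i); rewrite lerDl enorm_ge0.
    have h2 : enorm (row i x - (z + e *: G)) <= M.
      apply: le_trans (xM i); rewrite opprD addrA.
      apply: le_trans (enormB _ _) _; rewrite lerD2l enormZ gtr0_norm//.
      by rewrite ler_piMl ?enorm_ge0.
    have := pgrad_quadratic p2 h1 h2.
    rewrite (_ : row i x - (z + e *: G) - (row i x - z) = - (e *: G)); last first.
      by apply/rowP => k; rewrite !mxE; ring.
    rewrite enormN enormZ (gtr0_norm e0) -/K.
    move/(ler_wpM2l (ltW (lam0 i))); rewrite !dotrE.
    move: (lam i) (dotr _ _) (_ `^ p) (_ `^ p) (K) (enorm G) => l a b c k g; lra.
  rewrite !big_split/= sumrN -mulr_sumr -dotr_suml -mulr_suml lam1 mul1r.
  by rewrite -/G sqr_enorm.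
have := le_trans (zmin _) up => h; apply: enorm_eq0; apply/eqP.
rewrite -sqrf_eq0 eq_le sqr_ge0 andbT.
have e1' : e * (1 + K) = 1 by rewrite mulVf// gt_eqF// ltr_pwDl.
have c0 : 0 < p * e * e by rewrite !mulr_gt0.
rewrite -(pmulr_rle0 _ c0).
have -> : p * e * e * enorm G ^+ 2 = p * e * (e * (1 + K)) * enorm G ^+ 2
   - p * K * (e * enorm G) ^+ 2 by ring.
by move: h; rewrite e1' mulr1 subr_le0 -addrA lerDl addrC subr_ge0.
Qed.

(** By stationarity the first-order terms of the rows other than j sum to the opposite of the j-th
    one, so they are expressed through row j alone. The quadratic errors add up with total weight at
    most 1. *)
Lemma lp_energy_shift_but1 (R : realType) (N d : nat) (p M : R) (lam : 'I_N -> R)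
    (x : 'M[R]_(N, d)) (z tau : 'rV[R]_d) (j : 'I_N) :
  2 <= p -> (forall i, 0 < lam i) -> \sum_(i < N) lam i = 1 ->
  (forall w, lp_energy p lam x z <= lp_energy p lam x w) ->
  (forall i, enorm (row i x - z) <= M) ->
  (forall i, enorm (row i x - (z + tau)) <= M) ->
  \sum_(i < N | i != j) lam i * enorm (row i x - (z + tau)) `^ p
  <= \sum_(i < N | i != j) lam i * enorm (row i x - z) `^ p
     + p * (lam j * dotr (pgrad p (row j x - z)) tau)
     + p * (p * M `^ (p - 2)) * enorm tau ^+ 2.
Proof.
move=> p2 lam0 lam1 zmin zM ztM; set K := p * M `^ _.
have K0 : 0 <= K by rewrite mulr_ge0 ?powR_ge0//; lra.
apply: le_trans (_ : \sum_(i < N | i != j) (lam i * enorm (row i x - z) `^ p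
    + p * - dotr (lam i *: pgrad p (row i x - z)) tau
    + lam i * (p * K * enorm tau ^+ 2)) <= _).
  apply: ler_sum => i _; have := pgrad_quadratic p2 (zM i) (ztM i).
  rewrite (_ : row i x - (z + tau) - (row i x - z) = - tau); last first.
    by apply/rowP => k; rewrite !mxE; ring.
  rewrite enormN -/K.
  move/(ler_wpM2l (ltW (lam0 i))); rewrite !dotrE.
  move: (lam i) (dotr _ _) (_ `^ p) (_ `^ p) (K) (enorm tau) => l a b c k g.
  lra.
rewrite !big_split/= -mulr_sumr sumrN -dotr_suml -mulr_suml -addrA.
rewrite -[leRHS]addrA lerD2l.
apply: lerD.
  have := lp_energy_stationary p2 lam0 lam1 zmin.
  rewrite (bigD1 j)//= => /eqP; rewrite addrC addr_eq0 => /eqP ->.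
  by rewrite !dotrE opprK.
have p0 : 0 <= p by lra.
have le1 : \sum_(i < N | i != j) lam i <= 1.
  by rewrite -lam1 [leRHS](bigD1 j)//= lerDr ltW.
apply: ler_piMl => //; apply: mulr_ge0; last exact: sqr_ge0.
exact: mulr_ge0.
Qed.

(** * Exchanging one row under c-monotonicity *)

Lemma lp_energyD1 (R : realType) (N d : nat) (p : R) (lam : 'I_N -> R)
    (x : 'M[R]_(N, d)) (z : 'rV[R]_d) (j : 'I_N) :
  lp_energy p lam x z = lam j * enorm (row j x - z) `^ p
    + \sum_(i < N | i != j) lam i * enorm (row i x - z) `^ p.
Proof. exact: bigD1. Qed.

(** Take the transposition at j and the identity elsewhere; each exchanged cost is at most the
    energy at any competitor, here [w] and [w']. *)
Lemma lp_monotone_swap (R : realType) (N d : nat) (p : R) (lam : 'I_N -> R)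
    (Gamma : set 'M[R]_(N, d)) (y y' : 'M[R]_(N, d)) (w w' : 'rV[R]_d)
    (j : 'I_N) :
  (forall i, 0 < lam i) -> lp_monotone p lam Gamma -> Gamma y -> Gamma y' ->
  lp_cost p lam y + lp_cost p lam y' <=
    (lam j * enorm (row j y' - w) `^ p
      + \sum_(i < N | i != j) lam i * enorm (row i y - w) `^ p)
    + (lam j * enorm (row j y - w') `^ p
      + \sum_(i < N | i != j) lam i * enorm (row i y' - w') `^ p).
Proof.
move=> lam0 mono Gy Gy'.
have [x x0 x1] : exists2 x : 'I_2 -> 'M[R]_(N, d), x ord0 = y & x ord_max = y'.
  by exists (fun k => if k == ord0 then y else y').
have [s sj sNj] : exists2 s : 'I_N -> 'S_2,
    s j = tperm ord0 ord_max & forall i, i != j -> s i = 1%g.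
  exists (fun i => if i == j then tperm ord0 ord_max else 1%g).
    by rewrite eqxx.
  by move=> i /negPf ->.
have Gx k : Gamma (x k).
  have : k = ord0 \/ k = ord_max.
    by case: k => -[|[|//]] i; [left|right]; exact: val_inj.
  by case=> ->; rewrite ?x0 ?x1.
have sum2 (F : 'I_2 -> R) : \sum_(k < 2) F k = F ord0 + F ord_max.
  by rewrite big_ord_recl big_ord1; congr (_ + F _); exact: val_inj.
have := mono x s Gx; set E := (X in X <= _); set E' := (X in _ <= X).
have -> : E = lp_cost p lam (x ord0) + lp_cost p lam (x ord_max) by exact: sum2.
have -> : E' = lp_cost p lam (\matrix_(i < N) row i (x (s i ord0)))
    + lp_cost p lam (\matrix_(i < N) row i (x (s i ord_max))) by exact: sum2.
rewrite x0 x1 => h; apply: le_trans h _.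
have E0 : lp_energy p lam (\matrix_(i < N) row i (x (s i ord0))) w =
    lam j * enorm (row j y' - w) `^ p
      + \sum_(i < N | i != j) lam i * enorm (row i y - w) `^ p.
  rewrite (lp_energyD1 _ _ _ _ j) rowK sj tpermL x1; apply: (congr2 +%R (erefl _)).
  by apply: eq_bigr => i ij; rewrite rowK (sNj _ ij) perm1 x0.
have E1 : lp_energy p lam (\matrix_(i < N) row i (x (s i ord_max))) w' =
    lam j * enorm (row j y - w') `^ p
      + \sum_(i < N | i != j) lam i * enorm (row i y' - w') `^ p.
  rewrite (lp_energyD1 _ _ _ _ j) rowK sj tpermR x0; apply: (congr2 +%R (erefl _)).
  by apply: eq_bigr => i ij; rewrite rowK (sNj _ ij) perm1 x1.
apply: le_trans (lerD (lp_cost_le _ _ w lam0) (lp_cost_le _ _ w' lam0)) _.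
by rewrite E0 E1.
Qed.

(** The competitors are z + t e and z' - t e. The first-order terms of the two shifts add to those
    of [cross_gain] to form exactly the left side of [pgrad_swap_bound]; each shift also contributes
    one error K t^2 |e|^2. *)
Lemma swap_estimate (R : realType) (N d : nat) (p B t : R) (lam : 'I_N -> R)
    (Gamma : set 'M[R]_(N, d)) (y y' : 'M[R]_(N, d)) (j : 'I_N) :
  2 <= p -> (forall i, 0 < lam i) -> \sum_(i < N) lam i = 1 ->
  lp_monotone p lam Gamma -> Gamma y -> Gamma y' -> 0 <= t < 1 ->
  let z := barycenter p lam y in let z' := barycenter p lam y' in
  let e := row j y' - row j y in let zeta := z' - z in
  let K := p * (6 * B) `^ (p - 2) in
  enorm z <= B -> enorm z' <= B ->
  (forall i, enorm (row i y) <= B) -> (forall i, enorm (row i y') <= B) ->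
  lam j * (t * (1 - t) * enorm (row j y - z) `^ (p - 2) * enorm e ^+ 2 / 2)
  <= 2 * K * t ^+ 2 * enorm e ^+ 2
     + lam j * (K * (enorm zeta + enorm e) * enorm zeta).
Proof.
move=> p2; have p0 : 0 < p by lra.
have p1 : 1 <= p by lra.
(* The sum of the three norms is at most 4B; 6B leaves room and serves all differences at once. *)
have bound (u a c : 'rV[R]_d) : enorm u <= B -> enorm a <= B ->
    enorm c <= 2 * B -> enorm (u - (a + c)) <= 6 * B.
  move=> uB aB cB; apply: le_trans (enormB _ _) _.
  have := enormD a c; have := enorm_ge0 u.
  move: (enorm u) (enorm a) (enorm c) (enorm _) uB aB cB => *; lra.
have bound0 (u a : 'rV[R]_d) : enorm u <= B -> enorm a <= B ->
    enorm (u - a) <= 6 * B.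
  move=> uB aB; apply: le_trans (enormB _ _) _; have := enorm_ge0 u.
  move: (enorm u) (enorm a) uB aB => *; lra.
have vecE1 (a a' c : 'rV[R]_d) :
    a' - (c + t *: (a' - a)) = a - c + (1 - t) *: (a' - a).
  by apply/rowP => k; rewrite !mxE; ring.
have vecE2 (a a' c c' : 'rV[R]_d) :
    a - (c' + - (t *: (a' - a))) = a - c + (t *: (a' - a) - (c' - c)).
  by apply/rowP => k; rewrite !mxE; ring.
have vecE3 (a a' c c' : 'rV[R]_d) :
    a' - c' = a - c + (1 - t) *: (a' - a) + (t *: (a' - a) - (c' - c)).
  by apply/rowP => k; rewrite !mxE; ring.
move=> lam0 lam1 mono Gy Gy' /andP[t0 t1] z z' e zeta K zB z'B yB y'B.
pose v := row j y - z; pose tau := t *: e; pose s := (1 - t) *: e.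
pose eta := tau - zeta.
have B0 : 0 <= B by apply: le_trans zB; exact: enorm_ge0.
have eB : enorm e <= 2 * B.
  apply: le_trans (enormB _ _) _; rewrite mulr_natl mulr2n; exact: lerD.
have tauB : enorm tau <= 2 * B.
  rewrite enormZ ger0_norm//; apply: le_trans eB.
  by rewrite ler_piMl ?enorm_ge0// ltW.
have ntauB : enorm (- tau) <= 2 * B by rewrite enormN.
have E1 : row j y' - (z + tau) = v + s := vecE1 _ _ _.
have E2 : row j y - (z' + - tau) = v + eta := vecE2 _ _ _ _.
have E3 : row j y' - z' = v + s + eta := vecE3 _ _ _ _.
have zmin w : lp_energy p lam y z <= lp_energy p lam y w by exact: barycenter_min.
have z'min w : lp_energy p lam y' z' <= lp_energy p lam y' w.
  exact: barycenter_min.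
(* [T] makes the sums over the other rows opaque, so that they act as atoms in the linear arithmetic
   below. *)
have [T TE] : exists T : 'M[R]_(N, d) -> 'rV[R]_d -> R, forall x w,
    T x w = \sum_(i < N | i != j) lam i * enorm (row i x - w) `^ p.
  by eexists => x w; reflexivity.
have S1 : T y (z + tau) <= T y z + p * (lam j * dotr (pgrad p v) tau)
    + p * K * enorm tau ^+ 2.
  rewrite !TE; exact: (lp_energy_shift_but1 j p2 lam0 lam1 zmin
    (fun i => bound0 _ _ (yB i) zB) (fun i => bound _ _ _ (yB i) zB tauB)).
have S2 : T y' (z' + - tau) <= T y' z'
    + p * (lam j * dotr (pgrad p (row j y' - z')) (- tau))
    + p * K * enorm (- tau) ^+ 2.
  rewrite !TE; exact: (lp_energy_shift_but1 j p2 lam0 lam1 z'min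
    (fun i => bound0 _ _ (y'B i) z'B) (fun i => bound _ _ _ (y'B i) z'B ntauB)).
have S3 : lam j * enorm v `^ p + T y z
    + (lam j * enorm (row j y' - z') `^ p + T y' z')
    <= lam j * enorm (row j y' - (z + tau)) `^ p + T y (z + tau)
    + (lam j * enorm (row j y - (z' + - tau)) `^ p + T y' (z' + - tau)).
  have := lp_monotone_swap (z + tau) (z' + - tau) j lam0 mono Gy Gy'.
  rewrite (lp_cost_barycenter y p1 lam0 lam1) (lp_cost_barycenter y' p1 lam0 lam1).
  by rewrite -/z -/z' !(lp_energyD1 _ _ _ _ j) !TE.
move: S1 S2 S3; rewrite E1 E2 E3 enormN.
have -> : enorm tau ^+ 2 = t ^+ 2 * enorm e ^+ 2.
  by rewrite enormZ ger0_norm// exprMn.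
have := cross_gain v s eta p2 => /(ler_wpM2l (ltW (lam0 j))).
have vetaB : enorm (v + eta) <= 6 * B by rewrite -E2; exact: bound.
have vsB : enorm (v + s) <= 6 * B by rewrite -E1; exact: bound.
have /(ler_wpM2l (ltW (mulr_gt0 p0 (lam0 j)))) :=
  @pgrad_swap_bound R d p (6 * B) t v e zeta p2 (introT andP (conj t0 t1)) vetaB vsB.
rewrite -/tau -/s -/eta -/K -/v dotrNr [dotr (_ - _) tau]dotrDl dotrNl.
clear TE zmin z'min E1 E2 E3 vetaB vsB ntauB tauB eB.
clearbody K eta s tau v; clearbody zeta e; clearbody z z'.
move: (dotr _ eta) (dotr _ tau) (dotr _ tau) => D1 D2 D3.
move: (enorm v `^ (p - 2)) (enorm v `^ p) (enorm (v + s) `^ p) => G F1 F2.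
move: (enorm (v + eta) `^ p) (enorm (v + s + eta) `^ p) => F3 F4.
move: (T _ _) (T _ _) (T _ _) (T _ _) => T1 T2 T3 T4.
move: (lam j) (enorm e) (enorm zeta) (K) => l a b k.
(* Every inequality between powers carries a factor p from the gradient, which is divided out
   here. *)
move=> h1 h2 h3 h4 h5; rewrite -(ler_pM2l p0).
clear -h1 h2 h3 h4 h5; lra.
Qed.

(** * From the exchange estimate to a Lipschitz bound for one row *)

Lemma quadratic_absorb (R : realType) (kappa K : R) : 0 < kappa -> 0 <= K ->
  exists t C : R, [/\ 0 <= t < 1, 0 <= C & forall a b : R, 0 <= a -> 0 <= b ->
    kappa * (t * (1 - t) * a ^+ 2) <= 2 * K * t ^+ 2 * a ^+ 2 + K * (b + a) * b ->
    a <= C * b].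
Proof.
move=> k0 K0; have D0 : 0 < 8 * K + 2 * kappa by lra.
(* This choice means kappa / 2 = t (4K + kappa), so the gain of order t minus the loss of order t^2
   is at least c a^2; it also gives t <= 1/2. *)
pose t := kappa / (8 * K + 2 * kappa); pose c := kappa * t / 2.
have tE : t * (8 * K + 2 * kappa) = kappa by rewrite divfK// gt_eqF.
have t0 : 0 < t by rewrite divr_gt0.
have c0 : 0 < c by rewrite divr_gt0// mulr_gt0.
have C0 : 0 <= 2 * K / c by rewrite divr_ge0 ?(ltW c0)// mulr_ge0.
exists t, (1 + 2 * K / c); split.
- by rewrite (ltW t0) ltr_pdivrMr//; lra.
- by lra.
(* If a <= b, the summand 1 of the constant suffices. Otherwise b + a <= 2a, and one factor a
   cancels from c a^2 <= 2 K a b. *)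
move=> a b a0 b0 h; have [ab|ba] := leP a b.
  by rewrite mulrDl mul1r (le_trans ab)// lerDl mulr_ge0.
have a0' : 0 < a by apply: le_lt_trans ba.
rewrite mulrDl mul1r; apply: le_trans (_ : 2 * K / c * b <= _);
  last by rewrite lerDr.
rewrite mulrAC ler_pdivlMr// -(ler_pM2r a0').
have h1 : c * a ^+ 2 <= K * (b + a) * b.
  have : 0 <= t * (t * K) * a ^+ 2.
    have t0' := ltW t0; apply: mulr_ge0; last exact: sqr_ge0.
    by apply: mulr_ge0 => //; exact: mulr_ge0.
  have -> : c * a ^+ 2 = kappa * (t * (1 - t) * a ^+ 2) - 2 * K * t ^+ 2 * a ^+ 2
      - (kappa - t * (8 * K + 2 * kappa)) * t * a ^+ 2 / 2
      - 2 * (t * (t * K) * a ^+ 2) by rewrite /c; field.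
  rewrite tE subrr !mul0r; lra.
have h2 : K * (b + a) * b <= K * (2 * a) * b.
  by rewrite ler_wpM2r// ler_wpM2l//; lra.
lra.
Qed.

(** The lower bound [m] makes the coefficient [kappa] of the gain independent of the points, so
    [quadratic_absorb] yields a uniform constant. *)
Lemma barycenter_row_bound (R : realType) (N d : nat) (p B m : R)
    (lam : 'I_N -> R) (Gamma : set 'M[R]_(N, d)) (j : 'I_N) :
  2 <= p -> (forall i, 0 < lam i) -> \sum_(i < N) lam i = 1 ->
  lp_monotone p lam Gamma -> 0 < m ->
  exists2 C : R, 0 <= C & forall y y' : 'M[R]_(N, d), Gamma y -> Gamma y' ->
    enorm (barycenter p lam y) <= B -> enorm (barycenter p lam y') <= B ->
    (forall i, enorm (row i y) <= B) -> (forall i, enorm (row i y') <= B) ->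
    m <= enorm (row j y - barycenter p lam y) ->
    enorm (row j y - row j y')
      <= C * enorm (barycenter p lam y - barycenter p lam y').
Proof.
move=> p2; have q0 : 0 <= p - 2 by rewrite subr_ge0.
move=> lam0 lam1 mono m0.
pose K := p * (6 * B) `^ (p - 2).
have K0 : 0 <= K by rewrite mulr_ge0 ?powR_ge0//; lra.
pose kappa := lam j * m `^ (p - 2) / 2.
have k0 : 0 < kappa by rewrite divr_gt0// mulr_gt0// powR_gt0.
have [t [C [t01 C0 absorb]]] := quadratic_absorb k0 K0.
exists C => // y y' Gy Gy' zB z'B yB y'B mz.
rewrite -enormN opprB -(enormN (barycenter _ _ _ - _)) opprB.
apply: absorb; [exact: enorm_ge0|exact: enorm_ge0|].
have := swap_estimate j p2 lam0 lam1 mono Gy Gy' t01 zB z'B yB y'B.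
rewrite -/K; set e := row j y' - _.
set zeta := barycenter p lam y' - barycenter p lam y.
have le_m : m `^ (p - 2) <= enorm (row j y - barycenter p lam y) `^ (p - 2).
  by apply: ge0_ler_powR; rewrite // nnegrE ?enorm_ge0 ?(ltW m0).
(* This removes the weight from the error term. *)
have l1 : lam j <= 1.
  rewrite -lam1 (bigD1 j)//= lerDl.
  by apply: sumr_ge0 => i _; exact: ltW.
have /andP[t0 t1] := t01; have t1' : 0 <= 1 - t by rewrite subr_ge0 ltW.
have e0 := enorm_ge0 e; have zeta0 := enorm_ge0 zeta.
move=> h; apply: le_trans (_ : lam j * (t * (1 - t) *
    enorm (row j y - barycenter p lam y) `^ (p - 2) * enorm e ^+ 2 / 2) <= _).
  have -> : kappa * (t * (1 - t) * enorm e ^+ 2) =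
      lam j * (t * (1 - t) * m `^ (p - 2) * enorm e ^+ 2 / 2).
    by rewrite /kappa; move: (enorm e) (m `^ _) => a b; field.
  rewrite ler_wpM2l ?(ltW (lam0 j))// ler_wpM2r ?invr_ge0// ler_wpM2r ?sqr_ge0//.
  by rewrite ler_wpM2l// mulr_ge0.
apply: le_trans h _; rewrite lerD2l ler_piMl//.
by apply: mulr_ge0 => //; apply: mulr_ge0 => //; exact: addr_ge0.
Qed.

(** * The countable cover and the combination of the rows *)

Theorem proposition3p7 (R : realType) (N d : nat) (p : R) (lam : 'I_N -> R)
    (mu : 'I_N -> probability (borelType 'rV[R]_d) R)
    (gamma : probability (borelType 'M[R]_(N, d)) R) (S : {set 'I_N}) :
  (forall i, 0 < lam i) ->
  \sum_(i < N) lam i = 1 ->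
  2 <= p ->
  (forall i, finite_moment p (mu i)) ->
  coupling mu gamma ->
  lp_monotone p lam (spt gamma) ->
  S != [set: 'I_N]%SET ->
  exists U : nat -> set 'M[R]_(N, d),
    DS p lam S `&` spt gamma `<=` \bigcup_m U m /\
    forall m : nat, exists2 L : R, 0 < L &
      forall y y' : 'M[R]_(N, d),
        (DS p lam S `&` spt gamma `&` U m) y ->
        (DS p lam S `&` spt gamma `&` U m) y' ->
        L * Num.sqrt (\sum_(j < N | j \notin S) enorm (row j y - row j y') ^+ 2)
          <= enorm (barycenter p lam y - barycenter p lam y').
Proof.
move=> lam0 lam1 p2 _ _ mono _.
pose U (k : nat) : set 'M[R]_(N, d) := [set y |
  [/\ forall j, j \notin S -> k.+1%:R^-1 <= enorm (row j y - barycenter p lam y),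
      enorm (barycenter p lam y) <= k.+1%:R &
      forall i, enorm (row i y) <= k.+1%:R]].
exists U; split.
  move=> y [[_ yS] _].
  (* One number dominating all bounds; its integer part is the index of the cover. For j in S the
     distance is 0, and so is its inverse by convention. *)
  pose r := \sum_(j < N) (enorm (row j y - barycenter p lam y))^-1
    + enorm (barycenter p lam y) + \sum_(i < N) enorm (row i y).
  have s1 (F : 'I_N -> R) i : (forall k, 0 <= F k) -> F i <= \sum_(k < N) F k.
    by move=> F0; rewrite (bigD1 i)//= lerDl sumr_ge0.
  have inv0 k : 0 <= (enorm (row k y - barycenter p lam y))^-1.
    by rewrite invr_ge0 enorm_ge0.
  have row0 k : 0 <= enorm (row k y) by exact: enorm_ge0.
  have z0 := enorm_ge0 (barycenter p lam y).
  have S1 : 0 <= \sum_(j < N) (enorm (row j y - barycenter p lam y))^-1.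
    by apply: sumr_ge0 => k _.
  have S2 : 0 <= \sum_(i < N) enorm (row i y) by apply: sumr_ge0 => k _.
  have r0 : 0 <= r by rewrite !addr_ge0.
  have rk : r <= (Num.truncn r).+1%:R by rewrite ltW// truncnS_gt.
  exists (Num.truncn r) => //; split.
  - move=> j jS; have dj : 0 < enorm (row j y - barycenter p lam y).
      rewrite lt_neqAle enorm_ge0 andbT eq_sym; apply/eqP => /enorm_eq0/eqP.
      by rewrite subr_eq0 => /eqP/esym; exact: yS.
    rewrite -[leRHS]invrK lef_pV2 ?posrE ?invr_gt0//.
    apply: le_trans rk; apply: le_trans (s1 _ j inv0) _.
    by rewrite /r -addrA lerDl addr_ge0.
  - apply: le_trans rk; rewrite /r.
    by rewrite -addrA [leRHS]addrCA lerDl addr_ge0.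
  - move=> i; apply: le_trans rk; apply: le_trans (s1 _ i row0) _.
    by rewrite /r lerDr addr_ge0.
move=> k.
have k0 : 0 < (k.+1%:R : R)^-1 by rewrite invr_gt0.
have /choice[C CP] : forall j, exists C : R, 0 <= C /\
    forall y y' : 'M[R]_(N, d), j \notin S ->
    (DS p lam S `&` spt gamma `&` U k) y ->
    (DS p lam S `&` spt gamma `&` U k) y' ->
    enorm (row j y - row j y')
      <= C * enorm (barycenter p lam y - barycenter p lam y').
  move=> j; have [C C0 CP] :=
    barycenter_row_bound k.+1%:R j p2 lam0 lam1 mono k0.
  exists C; split=> // y y' jS [[_ Gy] [my zB yB]] [[_ Gy'] [_ z'B y'B]].
  exact: (CP _ _ Gy Gy' zB z'B yB y'B (my _ jS)).
(* Squaring and summing the row bounds gives the Lipschitz constant sqrt Q. *)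
pose Q := \sum_(j < N) C j ^+ 2.
have Q0 : 0 <= Q by apply: sumr_ge0 => j _; exact: sqr_ge0.
have sQ0 : 0 < 1 + Num.sqrt Q by rewrite ltr_pwDl ?sqrtr_ge0.
(* The added 1 keeps L positive and well defined when Q = 0. *)
exists (1 + Num.sqrt Q)^-1; first by rewrite invr_gt0.
move=> y y' Uy Uy'; rewrite ler_pdivrMl//.
have z0 := enorm_ge0 (barycenter p lam y - barycenter p lam y').
apply: le_trans (_ : Num.sqrt Q *
  enorm (barycenter p lam y - barycenter p lam y') <= _).
  rewrite -[X in _ * X](ger0_norm z0) -sqrtr_sqr -sqrtrM// ler_wsqrtr//.
  (* The terms of [Q] with j in S are nonnegative and are dropped. *)
  rewrite /Q mulr_suml [leRHS](bigID (fun j => j \in S))/= addrC.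
  rewrite ler_wpDr ?sumr_ge0// => [j _|]; first by rewrite mulr_ge0 ?sqr_ge0.
  apply: ler_sum => j jS; rewrite -exprMn ler_sqr ?nnegrE ?enorm_ge0//.
    by have [_] := CP j; exact.
  by rewrite mulr_ge0//; have [] := CP j.
by rewrite ler_wpM2r// lerDr.
Qed.
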